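(* For every $n\ge 1$ there is a bijection between $\mathcal{RS}_n(231)$ and $\mathcal{RS}_n(213)$.
   Context: For $\sigma\in\mathfrak{S}_n$, a double descent is an index $i$ with $\sigma_i>\sigma_{i+1}>\sigma_{i+2}$. The permutation $\sigma$ is simsun if for every $k$, the subword of $\sigma$ consisting of the letters in $\{1,\dots,k\}$ (in the order they appear in $\sigma$) has no double descent. For $\omega\in\mathfrak{S}_t$, $\sigma$ contains an $\omega$-pattern if there are indices $i_1<\cdots<i_t$ with $\sigma_{i_j}<\sigma_{i_k}$ iff $\omega_j<\omega_k$; otherwise $\sigma$ avoids $\omega$. $\mathcal{RS}_n(\omega)$ is the set of $\omega$-avoiding simsun permutations in $\mathfrak{S}_n$. *)

(* Defs.v *)
From mathcomp Require Import all_boot all_fingroup.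

Set Implicit Arguments.
Unset Strict Implicit.
Unset Printing Implicit Defensive.

(* The elements of 'S_n permute {0, ..., n-1}; the one-line word uses the
   letters 1, ..., n. *)
Definition oneline (n : nat) (s : 'S_n) : seq nat :=
  [seq (s i).+1 | i <- enum 'I_n].

Definition double_descent (w : seq nat) (i : nat) : bool :=
  [&& i.+2 < size w, nth 0 w i.+1 < nth 0 w i & nth 0 w i.+2 < nth 0 w i.+1].

Definition no_double_descent (w : seq nat) : bool :=
  [forall i : 'I_(size w), ~~ double_descent w i].

Definition subword (k : nat) (w : seq nat) : seq nat :=
  [seq x <- w | 1 <= x <= k].

Definition simsun (n : nat) (s : 'S_n) : bool :=
  [forall k : 'I_n.+1, no_double_descent (subword k (oneline s))].

Definition contains (t n : nat) (w : 'S_t) (s : 'S_n) : bool :=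
  [exists i : {ffun 'I_t -> 'I_n},
    [forall j : 'I_t, forall k : 'I_t, (j < k) ==> (i j < i k)] &&
    [forall j : 'I_t, forall k : 'I_t, (s (i j) < s (i k)) == (w j < w k)]].

Definition avoids (t n : nat) (w : 'S_t) (s : 'S_n) : bool := ~~ contains w s.

Definition RS (n t : nat) (w : 'S_t) : {set 'S_n} :=
  [set s : 'S_n | simsun s & avoids w s].

Definition fun231 (i : 'I_3) : 'I_3 :=
  tnth [tuple @Ordinal 3 1 isT; @Ordinal 3 2 isT; @Ordinal 3 0 isT] i.

Lemma fun231_inj : injective fun231.
Proof. by case=> [[|[|[|?]]] // ?] [[|[|[|?]]] // ?] // _; apply: val_inj. Qed.

Definition p231 : 'S_3 := perm fun231_inj.

Lemma oneline_p231 : oneline p231 = [:: 2; 3; 1].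
Proof. by rewrite /oneline !enum_ordSl /= !permE; case: (enum _) (size_enum_ord 0). Qed.

Definition fun213 (i : 'I_3) : 'I_3 :=
  tnth [tuple @Ordinal 3 1 isT; @Ordinal 3 0 isT; @Ordinal 3 2 isT] i.

Lemma fun213_inj : injective fun213.
Proof. by case=> [[|[|[|?]]] // ?] [[|[|[|?]]] // ?] // _; apply: val_inj. Qed.

Definition p213 : 'S_3 := perm fun213_inj.

Lemma oneline_p213 : oneline p213 = [:: 2; 1; 3].
Proof. by rewrite /oneline !enum_ordSl /= !permE; case: (enum _) (size_enum_ord 0). Qed.

(* Main.v *)
(** Both classes are grown by inserting the new largest letter n+1 into a word of
    size n, and both growths follow the same succession rule. Inserting n+1 keeps
    a word simsun unless it lands just before a descent. It keeps a word
    231-avoiding iff every letter before it is smaller than every letter after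
    it, and 213-avoiding iff the letters before it are increasing. Under either
    rule a word with k admissible sites has k children, and these have
    1, 2, ..., k-1 and k+1 admissible sites: inserting at the j-th site leaves j
    of them, except that the last site (the end of the word for 231, the end of
    the initial increasing run for 213) yields k+1. The two generating trees are
    therefore isomorphic, so the classes are equinumerous. *)

Require Import Defs.
From mathcomp Require Import all_boot all_fingroup.

(** * Words on the letters 1 to n and insertion of a new largest letter *)

Definition word (n : nat) (w : seq nat) : bool := perm_eq w (iota 1 n).

Definition ins (i x : nat) (w : seq nat) : seq nat := take i w ++ x :: drop i w.

Lemma word_size n w : word n w -> size w = n.
Proof. by move/perm_size; rewrite size_iota. Qed.

Lemma word_lt n w : word n w -> all (gtn n.+1) w.
Proof.
by move=> /perm_mem hw; apply/allP => y; rewrite hw mem_iota add1n => /andP[].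
Qed.

Lemma word_notin n w : word n w -> n.+1 \notin w.
Proof. by move=> /word_lt/allP hw; apply/negP => /hw /=; rewrite ltnn. Qed.

Lemma word_ins n w i : word n.+1 (ins i n.+1 w) = word n w.
Proof.
have e : perm_eq (iota 1 n.+1) (n.+1 :: iota 1 n).
  by rewrite -[in iota 1 n.+1](addn1 n) iotaD cats1 add1n perm_rcons.
rewrite /word /ins (permPr e) -cat1s perm_catCA /= perm_cons cat_take_drop //.
Qed.

Lemma index_ins i x w : i <= size w -> x \notin w -> index x (ins i x w) = i.
Proof.
move=> hi hx; rewrite index_cat /= eqxx addn0 size_takel //.
by rewrite (negbTE (contra (@mem_take _ _ _ _) hx)).
Qed.

(** Since [n.+1] occurs in neither word, its index in the result recovers the site, and cutting
    there recovers the word. *)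
Lemma ins_inj n v w i j : word n v -> word n w -> i <= n -> j <= n ->
  ins i n.+1 v = ins j n.+1 w -> v = w /\ i = j.
Proof.
move=> hv hw hi hj e.
have eij : i = j.
  rewrite -(@index_ins i n.+1 v) ?(word_size _ _ hv) ?(word_notin _ _ hv) // e.
  by rewrite index_ins ?(word_size _ _ hw) ?(word_notin _ _ hw).
split=> //; move: e; rewrite -eij => /eqP.
rewrite eqseq_cat ?size_takel ?(word_size _ _ hv) ?(word_size _ _ hw) //.
case/andP=> /eqP e1 /eqP [e2].
by rewrite -(cat_take_drop i v) e1 e2 cat_take_drop.
Qed.

Lemma word_insP n v : word n.+1 v ->
  exists w i, [/\ word n w, i <= n & v = ins i n.+1 w].
Proof.
move=> hv; have hin : n.+1 \in v by rewrite (perm_mem hv) mem_iota /= add1n ltnSn.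
have hi : index n.+1 v <= n.
  by rewrite -ltnS (leq_trans _ (eq_leq (word_size _ _ hv))) ?index_mem.
pose w := take (index n.+1 v) v ++ drop (index n.+1 v).+1 v.
have sz : size (take (index n.+1 v) v) = index n.+1 v.
  by rewrite size_takel // index_size.
have ev : v = ins (index n.+1 v) n.+1 w.
  rewrite /ins /w take_size_cat // drop_size_cat //.
  by rewrite -{2}(nth_index 0 hin) -drop_nth ?index_mem // cat_take_drop.
exists w, (index n.+1 v); split=> //.
by rewrite -(word_ins n w (index n.+1 v)) -ev.
Qed.

(** * Generating trees and their labels *)

Definition sites (ok : seq nat -> pred nat) (w : seq nat) : seq nat :=
  [seq i <- iota 0 (size w).+1 | ok w i].

(** This form makes the class closed under deleting the largest letter, so every member of size
    [n.+1] grows from a member of size [n]. *)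
Definition insertion_rule (P : pred (seq nat)) (ok : seq nat -> pred nat) :=
  forall n w i, word n w -> i <= n -> P (ins i n.+1 w) = P w && ok w i.

Fixpoint gen (ok : seq nat -> pred nat) (n : nat) : seq (seq nat) :=
  if n is m.+1 then [seq ins i m.+1 w | w <- gen ok m, i <- sites ok w]
  else [:: [::]].

Lemma mem_gen (P : pred (seq nat)) ok n v : P [::] -> insertion_rule P ok ->
  (v \in gen ok n) = word n v && P v.
Proof.
move=> P0 rule; elim: n v => [|n IHn] v.
  rewrite inE /word /= perm_sym; case: v => [|a v] /=; first by rewrite P0.
  by apply/esym/negbTE; rewrite negb_and; apply/orP; left; apply/negP => /perm_size.
apply/allpairsPdep/andP => [[w [i [hw hi ->]]]|[hv Pv]].
  move: hw hi; rewrite IHn mem_filter mem_iota ltnS => /andP[hw Pw].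
  rewrite (word_size _ _ hw) => /and3P[oki _ hi].
  by rewrite word_ins hw rule // Pw oki.
have [w [i [hw hi ev]]] := word_insP _ _ hv.
move: Pv; rewrite ev rule // => /andP[Pw oki]; exists w, i; split=> //.
  by rewrite IHn hw.
by rewrite mem_filter oki mem_iota ltnS (word_size _ _ hw).
Qed.

(** The sites of one word are distinct, and by [ins_inj] a word on the next level determines both
    its parent and its site. *)
Lemma gen_uniq (P : pred (seq nat)) ok n :
  P [::] -> insertion_rule P ok -> uniq (gen ok n).
Proof.
move=> P0 rule; elim: n => [|n IHn] //.
apply: allpairs_uniq_dep => // [w _|]; first by rewrite filter_uniq ?iota_uniq.
have in_st u : u \in [seq existT (fun=> nat) w i | w <- gen ok n, i <- sites ok w] ->
    word n (tag u) /\ tagged u <= n.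
  case/allpairsPdep=> w [i [+ + ->]] /=.
  rewrite (mem_gen P) // mem_filter mem_iota ltnS => /andP[hw _].
  by rewrite (word_size _ _ hw) => /and3P[_ _ hi]; split.
move=> [v i] [w j] /in_st[/= hv hi] /in_st[/= hw hj] /=.
by move=> /(ins_inj _ _ _ _ _ hv hw hi hj) [-> ->].
Qed.

Definition children (k : nat) : seq nat := rcons (iota 1 k.-1) k.+1.

Fixpoint labels (n : nat) : seq nat :=
  if n is m.+1 then flatten [seq children k | k <- labels m] else [:: 1].

(** The label of a word is its number of sites. The children are compared as lists, from the
    leftmost site to the rightmost, so two trees with this rule have the same label sequence on each
    level. *)
Definition label_rule (P : pred (seq nat)) (ok : seq nat -> pred nat) :=
  forall n w, word n w -> P w ->
  [seq size (sites ok (ins i n.+1 w)) | i <- sites ok w]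
    = children (size (sites ok w)).

Lemma labels_gen (P : pred (seq nat)) (ok : seq nat -> pred nat) n :
  P [::] -> ok [::] 0 ->
  insertion_rule P ok -> label_rule P ok ->
  [seq size (sites ok w) | w <- gen ok n] = labels n.
Proof.
move=> P0 ok0 rule lab; elim: n => [|n IHn] /=; first by rewrite /sites /= ok0.
rewrite map_allpairs -IHn -map_comp; congr flatten; apply/eq_in_map => w.
by rewrite (mem_gen P) // => /andP[hw Pw]; apply: lab.
Qed.

(** * Effect of the insertion on the simsun condition and on the two patterns *)

Definition des (w : seq nat) : bool := if w is a :: b :: _ then b < a else false.

Fixpoint ndd (w : seq nat) : bool :=
  if w is a :: t then ndd t && ~~ (des (a :: t) && des t) else true.

(** The step into the maximum [x] is an ascent and the step out of it a descent, so a new double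
    descent can only start at [x], and it does exactly when [R] starts with a descent. *)
Lemma ndd_cat_max x L R : all (gtn x) (L ++ R) -> ndd (L ++ R) ->
  ndd (L ++ x :: R) = ~~ des R.
Proof.
elim: L => [|a L IHL] /=.
  by move=> hx ->; case: R hx => [|b R] //= /andP[-> _].
case/andP=> hax hL /andP[nddL nd]; rewrite IHL //.
case: L nd {IHL nddL} hL => [|b [|c L]] /=; rewrite ?(ltnNge x) ?(ltnW hax) ?andbT //.
  by move=> _ /andP[hb _]; rewrite (ltnW hb) !andbF andbT.
by move=> -> _; rewrite andbT.
Qed.

Lemma no_double_descentE w : no_double_descent w = ndd w.
Proof.
apply/forallP/idP => [|/[swap] -[i hi]].
  elim: w => [|a w IHw] //= h; rewrite IHw /=.
    have := h ord0; rewrite /double_descent.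
    by case: w {IHw h} => [|b [|c w]] //=; rewrite ?andbF.
  by move=> [i hi]; apply: (h (@Ordinal (size (a :: w)) i.+1 hi)).
rewrite /double_descent /=; elim: w i {hi} => [|a w IHw] // [|i] /=.
  by case: w {IHw} => [|b [|c w]] //= /andP[].
by case/andP=> /IHw nd _; apply: nd.
Qed.

Definition wsimsun (w : seq nat) : bool :=
  all (fun k => ndd (subword k w)) (iota 0 (size w).+1).

Lemma subword_word n w k : word n w -> n <= k -> subword k w = w.
Proof.
move=> hw hk; apply/all_filterP/allP => y; rewrite (perm_mem hw) mem_iota add1n ltnS.
by case/andP=> -> /leq_trans -> .
Qed.

(** The subwords for [k <= n] do not see the new letter; only the subword for [k = n.+1], the whole
    word, gives a new condition. *)
Lemma wsimsun_rule n w i : word n w -> i <= n ->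
  wsimsun (ins i n.+1 w) = wsimsun w && ~~ des (drop i w).
Proof.
move=> hw hi; have hv : word n.+1 (ins i n.+1 w) by rewrite word_ins.
rewrite /wsimsun (word_size _ _ hv) (word_size _ _ hw) -(addn1 n.+1) iotaD all_cat.
rewrite [all _ (iota _ 1)]/= andbT add0n (subword_word _ _ _ hv) //.
have -> : all (fun k => ndd (subword k (ins i n.+1 w))) (iota 0 n.+1)
    = all (fun k => ndd (subword k w)) (iota 0 n.+1).
  apply: eq_in_all => k; rewrite mem_iota add0n /= => hk.
  rewrite /subword /ins filter_cat /= ltnNge -ltnS hk.
  by rewrite -filter_cat cat_take_drop.
case: (@allP _ _ (iota 0 n.+1)) => [|_]; last by [].
(* The case [k = n] says that [w] itself has no double descent, as [ndd_cat_max] requires. *)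
move=> /(_ n); rewrite mem_iota leq0n ltnSn (subword_word n) //.
by move=> /(_ isT) nw; rewrite /= /ins ndd_cat_max ?cat_take_drop // word_lt.
Qed.

(* [r a b c] says that the word abc is an occurrence of the pattern. *)
Fixpoint wavoids (r : nat -> nat -> nat -> bool) (w : seq nat) : bool :=
  if w is a :: t then pairwise (fun b c => ~~ r a b c) t && wavoids r t else true.

Definition r231 (a b c : nat) : bool := c < a < b.
Definition r213 (a b c : nat) : bool := b < a < c.

(** The maximum [x] can only play the 3 of 231, so a new occurrence is a letter of [L] exceeding a
    letter of [R]. *)
Lemma wavoids231_rule x L R : all (gtn x) (L ++ R) ->
  wavoids r231 (L ++ x :: R) = wavoids r231 (L ++ R) && allrel leq L R.
Proof.
elim: L => [|a L IHL] /= hx.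
  rewrite andbT; have -> // : pairwise (fun b c => ~~ r231 x b c) R.
  elim: R hx => //= b R IHR /andP[hb hR]; rewrite IHR // andbT.
  by apply: allT => c; rewrite /r231 (ltnNge x) (ltnW hb) andbF.
case/andP: hx => hax hx; rewrite (IHL hx) allrel_consl !pairwise_cat /= allrel_consr.
have -> : all (fun b => ~~ r231 a b x) L.
  by apply: allT => b; rewrite /r231 (ltnNge x) (ltnW hax).
have -> : all (fun c => ~~ r231 a x c) R = all (leq a) R.
  by apply: eq_all => c; rewrite /r231 hax andbT -leqNgt.
rewrite /=; do !case: (all _ _); do !case: (allrel _ _ _) => //=;
  by do !case: (pairwise _ _) => //=; rewrite ?andbF.
Qed.

(** Here the 3 comes last, so a new occurrence is a decreasing pair inside [L]. *)
Lemma wavoids213_rule x L R : all (gtn x) (L ++ R) ->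
  wavoids r213 (L ++ x :: R) = wavoids r213 (L ++ R) && pairwise leq L.
Proof.
elim: L => [|a L IHL] /= hx.
  rewrite andbT; have -> // : pairwise (fun b c => ~~ r213 x b c) R.
  elim: R hx => //= b R IHR /andP[hb hR]; rewrite IHR // andbT.
  apply/allP => c /(allP hR) /= hc.
  by rewrite /r213 (ltnNge x) (ltnW hc) andbF.
case/andP: hx => hax hx; rewrite (IHL hx) !pairwise_cat /= allrel_consr.
have -> : all (fun c => ~~ r213 a x c) R.
  by apply: allT => b; rewrite /r213 (ltnNge x) (ltnW hax).
have -> : all (fun b => ~~ r213 a b x) L = all (leq a) L.
  by apply: eq_all => c; rewrite /r213 hax andbT -leqNgt.
rewrite /=; do !case: (all _ _); do !case: (allrel _ _ _) => //=;
  by do !case: (pairwise _ _) => //=; rewrite ?andbF.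
Qed.

Definition simsun231 (w : seq nat) : bool := wsimsun w && wavoids r231 w.
Definition simsun213 (w : seq nat) : bool := wsimsun w && wavoids r213 w.

Definition ok231 (w : seq nat) (i : nat) : bool :=
  allrel leq (take i w) (drop i w) && ~~ des (drop i w).

Definition ok213 (w : seq nat) (i : nat) : bool :=
  pairwise leq (take i w) && ~~ des (drop i w).

Lemma insertion231 : insertion_rule simsun231 ok231.
Proof.
move=> n w i hw hi; rewrite /simsun231 wsimsun_rule // /ins wavoids231_rule cat_take_drop.
  by rewrite /ok231 [X in _ = _ && X]andbC andbACA.
exact: word_lt.
Qed.

Lemma insertion213 : insertion_rule simsun213 ok213.
Proof.
move=> n w i hw hi; rewrite /simsun213 wsimsun_rule // /ins wavoids213_rule cat_take_drop.
  by rewrite /ok213 [X in _ = _ && X]andbC andbACA.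
exact: word_lt.
Qed.

(** * Sites and labels for 213 *)

Lemma sites_ins213 m u j : word m u -> j <= m -> ok213 u j ->
  sites ok213 (ins j m.+1 u)
    = iota 0 j ++ (if j == m then [:: j; j.+1] else [:: j.+1]).
Proof.
move=> hu hj /andP[]; have szu := word_size _ _ hu.
have : all (gtn m.+1) (take j u ++ drop j u) by rewrite cat_take_drop word_lt.
(* Reading [j == m] as emptiness of the tail allows [u] and [j] to be replaced by the two halves [L]
   and [R]. *)
have -> : (j == m) = (drop j u == [::]).
  by rewrite -size_eq0 size_drop szu subn_eq0 eqn_leq hj.
have szL : size (take j u) = j by rewrite size_takel ?szu.
rewrite /ins; move: (take j u) (drop j u) szL => L R <- {j hj u hu szu} hx hL hR.
rewrite /sites size_cat -addnS iotaD filter_cat; congr (_ ++ _).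
  (* Every site before the new letter is admissible: [L] followed by [m.+1] is increasing. *)
  apply/all_filterP/allP => j; rewrite mem_iota add0n /= => hj.
  rewrite /ok213 takel_cat ?drop_cat ?hj ?(ltnW hj) //.
  rewrite (subseq_pairwise (take_subseq _ _)) //=.
  have : pairwise leq (drop j L) by exact: (subseq_pairwise (drop_subseq _ _)).
  have : all (gtn m.+1) (drop j L).
    by apply/allP => y /mem_drop hy; apply: (allP hx); rewrite mem_cat hy.
  have : size (drop j L) != 0 by rewrite size_drop subn_eq0 -ltnNge.
  case: (drop j L) => [|a [|b D]] //= _; first by rewrite andbT (ltnNge m.+1) => /ltnW ->.
  by move=> _ /andP[/andP[ab _] _]; rewrite -leqNgt.
rewrite add0n [iota _ _]/= [filter _ _]/=.
(* Just before the new letter a descent follows unless [m.+1] ends the word. *)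
have -> : ok213 (L ++ m.+1 :: R) (size L) = (R == [::]).
  rewrite /ok213 take_size_cat // drop_size_cat // hL /=.
  by case: R hx {hR} => //= b R; rewrite all_cat /= => /and3P[_ -> _].
have -> : ok213 (L ++ m.+1 :: R) (size L).+1.
  rewrite /ok213 -cat_rcons take_size_cat ?drop_size_cat ?size_rcons // hR andbT.
  rewrite -cats1 pairwise_cat hL allrel1r /= andbT.
  by apply/allP => y hy; apply/ltnW/(allP hx); rewrite mem_cat hy.
(* Further right the prefix contains [m.+1] followed by a smaller letter, so it is not
   increasing. *)
have -> : [seq j <- iota (size L).+2 (size R) | ok213 (L ++ m.+1 :: R) j] = [::].
  apply/eqP; rewrite -(negbK (_ == _)) -has_filter; apply/hasPn => j.
  rewrite mem_iota => /andP[hj hjR]; apply/negP => /andP[+ _].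
  rewrite take_cat ltnNge (ltnW (ltnW hj)) /= pairwise_cat => /and3P[_ _].
  case: R hx hR hjR => [|b R] hx _; first by rewrite addn0 ltnNge hj.
  move=> _; have -> : j - size L = (j - (size L).+2).+2.
    by rewrite -[in LHS](subnKC hj) -addn2 -addnA addKn add2n.
  move: hx; rewrite all_cat /= => /and3P[_ hb _] /andP[/andP[]].
  by rewrite leqNgt hb.
by case: (R == [::]).
Qed.

Lemma size_sites_ins213 m u j : word m u -> j <= m -> ok213 u j ->
  size (sites ok213 (ins j m.+1 u)) = (j + (j == m)).+1.
Proof.
move=> hu hj oj; rewrite sites_ins213 // size_cat size_iota.
by case: eqP => _; rewrite /= ?addn1 ?addn2 ?addn0.
Qed.

(** The sites are explicit only for a word that is itself an insertion, so the largest letter of [w]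
    is peeled off first; the empty word is treated apart. *)
Lemma label213 : label_rule simsun213 ok213.
Proof.
have iotaS k m : k <= m -> [seq (i + (i == m)).+1 | i <- iota 0 k] = iota 1 k.
  move=> hk; rewrite -[1]addn0 iotaDl; apply/eq_in_map => i; rewrite mem_iota => hi.
  by rewrite add1n ltn_eqF ?addn0 // (leq_trans _ hk).
move=> n w hw Pw.
have -> : [seq size (sites ok213 (ins i n.+1 w)) | i <- sites ok213 w]
   = [seq (i + (i == n)).+1 | i <- sites ok213 w].
  apply/eq_in_map => i; rewrite mem_filter mem_iota (word_size _ _ hw) ltnS.
  by case/and3P=> oi _ hi; apply: size_sites_ins213.
case: n hw => [|n] hw; first by have /size0nil -> := word_size _ _ hw.
have [u [j [hu hj e]]] := word_insP _ _ hw.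
move: Pw; rewrite e insertion213 // => /andP[_ oj].
rewrite (size_sites_ins213 n u j) // sites_ins213 // map_cat iotaS ?(leqW hj) //.
(* If the largest letter of [w] is at its end, the sites are all of 0 to [n.+1]; otherwise they are
   0 to [j.-1] and [j.+1]. *)
rewrite /children /= -cats1; case: eqP hj => [-> _|/eqP hne hj] /=.
  rewrite (ltn_eqF (ltnSn n)) eqxx addn0 !addn1.
  by rewrite -[in RHS](addn1 n) iotaD add1n -catA addn1.
have hjn : j < n by rewrite ltn_neqAle hne.
by rewrite (ltn_eqF (_ : j.+1 < n.+1)) // !addn0.
Qed.

(** * Sites and labels for 231 *)

Lemma sites_ins231 m u j : word m u -> j <= m -> ok231 u j ->
  sites ok231 (ins j m.+1 u)
    = [seq k <- iota 0 j | ok231 u k] ++ (if j == m then [:: j; m.+1] else [:: m.+1]).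
Proof.
move=> hu hj /andP[]; have szu := word_size _ _ hu.
have : all (gtn m.+1) (take j u ++ drop j u) by rewrite cat_take_drop word_lt.
have szL : size (take j u) = j by rewrite size_takel ?szu.
rewrite /ins; have := cat_take_drop j u.
have : size (drop j u) = m - j by rewrite size_drop szu.
move: (take j u) (drop j u) szL => L R szL szR eu; rewrite -{}eu in hu szu * => hx hL hR.
move: hj szR; rewrite -{}szL => hj szR.
rewrite /sites size_cat -addnS iotaD filter_cat; congr (_ ++ _).
  apply: eq_in_filter => k; rewrite mem_iota add0n /= => hk.
  rewrite /ok231 !takel_cat ?drop_cat ?hk ?(ltnW hk) //.
  rewrite !allrel_catr allrel_consr.
  have -> : all (leq^~ m.+1) (take k L).
    by apply/allP => y /mem_take hy; apply/ltnW/(allP hx); rewrite mem_cat hy.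
  (* Only the site before the final letter of [L] sees a changed next step: that letter is now
     followed by [m.+1] instead of the head of [R], and neither makes a descent. *)
  congr (_ && ~~ _).
  have : all (gtn m.+1) (drop k L).
    by apply/allP => y /mem_drop hy; apply: (allP hx); rewrite mem_cat hy.
  have : allrel leq (drop k L) R by apply/allrelP => x y /mem_drop hxL; apply: (allrelP hL).
  have : size (drop k L) != 0 by rewrite size_drop subn_eq0 -ltnNge.
  case: (drop k L) => [|a [|b D]] //= _; rewrite ?allrel_consl => /andP[aR _].
  rewrite andbT => /ltnW ha; rewrite ltnNge ha.
  by case: (R) aR => //= b ? /andP[ab _]; rewrite ltnNge ab.
have okend : ok231 (L ++ m.+1 :: R) (size (L ++ m.+1 :: R)).
  by rewrite /ok231 take_size drop_size allrel0r.
have e : (size L == m) = (R == [::]) by rewrite -size_eq0 szR subn_eq0 eqn_leq hj.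
have szv : size (L ++ m.+1 :: R) = m.+1 by rewrite size_cat /= addnS -size_cat szu.
move: okend; rewrite szv e add0n.
case: R hx hL hR szR szv {hu szu e} => [|b R] hx hL hR szR szv okend.
  have eL : size L = m by move: szv; rewrite size_cat addn1 => -[].
  rewrite eL /= okend /ok231 -eL take_size_cat // drop_size_cat //= allrel1r andbT.
  have -> // : all (leq^~ (size L).+1) L.
  by apply/allP => y hy; apply/ltnW; rewrite eL; apply: (allP hx); rewrite mem_cat hy.
(* With [R] nonempty, the end of the word is split off; no other site from [size L] on survives. *)
rewrite -[(size _).+1]addn1 iotaD -size_cat szv filter_cat [X in _ ++ X]/= okend.
have -> // : [seq k <- iota (size L) (size (m.+1 :: b :: R))
              | ok231 (L ++ m.+1 :: b :: R) k] = [::].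
apply/eqP; rewrite -(negbK (_ == _)) -has_filter; apply/hasPn => k.
rewrite mem_iota -size_cat => /andP[hk hkR].
move: hx; rewrite all_cat => /andP[_ hx].
rewrite /ok231 take_cat drop_cat ltnNge hk /=.
(* Offset 0 is the site just before [m.+1], where a descent starts; at any larger offset [m.+1] lies
   to the left of a smaller letter. *)
have := hkR; rewrite size_cat -ltn_subLR //; case: (k - size L) => [|d] /= hd.
  by case/andP: hx => /= -> _; rewrite andbF.
rewrite allrel_catl allrel_consl; apply/negP => /andP[/andP[_ /andP[+ _]] _].
have : size (drop d (b :: R)) != 0 by rewrite size_drop subn_eq0 -ltnNge.
have : all (gtn m.+1) (drop d (b :: R)) by apply/allP => y /mem_drop /(allP hx).
by case: (drop d _) => //= c D /andP[hc _] _; rewrite leqNgt [_ < _]hc.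
Qed.

(** Inserting at a site before the end keeps the sites to its left and adds the end, so its label is
    its rank among the sites; inserting at the end keeps all sites and adds one. *)
Lemma label231 : label_rule simsun231 ok231.
Proof.
(* One plus the number of selected elements below a selected element is its rank, so the ranks run
   through 1, 2, and so on. *)
have filter_iota p k : [seq (size (filter p (iota 0 i))).+1 | i <- filter p (iota 0 k)]
    = iota 1 (size (filter p (iota 0 k))).
  elim: k => // k IHk; rewrite -[k.+1]addn1 iotaD filter_cat map_cat IHk add0n /=.
  by case: ifP => _; rewrite ?cats0 // size_cat iotaD add1n.
move=> n w hw _; pose A := [seq i <- iota 0 n | ok231 w i].
have eA : sites ok231 w = rcons A n.
  have okn : ok231 w n.
    by rewrite /ok231 -(word_size _ _ hw) take_size drop_size allrel0r.
  by rewrite /sites (word_size _ _ hw) -[n.+1]addn1 iotaD filter_cat /= okn cats1.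
have oki i : i \in sites ok231 w -> i <= n /\ ok231 w i.
  by rewrite mem_filter mem_iota (word_size _ _ hw) => /and3P[].
rewrite /children eA size_rcons /= -filter_iota map_rcons; congr rcons.
  apply/eq_in_map => i; rewrite mem_filter mem_iota => /and3P[oi _ hi].
  by rewrite (sites_ins231 n) ?(ltnW hi) // (ltn_eqF hi) size_cat addn1.
rewrite (sites_ins231 n) ?eqxx ?size_cat ?addn2 //.
by case: (oki n); rewrite // eA mem_rcons mem_head.
Qed.

(** * Equal level sizes *)

(** Labelling a level does not change its length, and both label lists are [labels n]. *)
Lemma size_gen_eq n : size (gen ok231 n) = size (gen ok213 n).
Proof.
rewrite -[LHS](size_map (fun w => size (sites ok231 w))).
rewrite -[RHS](size_map (fun w => size (sites ok213 w))).
rewrite (labels_gen simsun231) //; last exact: label231; last exact: insertion231.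
by rewrite (labels_gen simsun213) //; [exact: insertion213 | exact: label213].
Qed.

(** * From words back to permutations *)

Lemma nth_oneline n (s : 'S_n) (i : 'I_n) : nth 0 (oneline s) i = (s i).+1.
Proof. by rewrite (nth_map i) ?size_enum_ord // nth_ord_enum. Qed.

Lemma size_oneline n (s : 'S_n) : size (oneline s) = n.
Proof. by rewrite size_map size_enum_ord. Qed.

Lemma oneline_inj n : injective (@oneline n).
Proof.
move=> s t e; apply/permP => i; apply/val_inj/succn_inj.
by rewrite -!nth_oneline e.
Qed.

Lemma word_oneline n (s : 'S_n) : word n (oneline s).
Proof.
have us : uniq (oneline s).
  by rewrite map_inj_uniq ?enum_uniq // => i j [] /val_inj /perm_inj.
have sub : {subset oneline s <= iota 1 n}.
  by move=> x /mapP[i _ ->]; rewrite mem_iota add1n; apply: ltn_ord.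
apply: uniq_perm; rewrite ?iota_uniq //.
by have [] := uniq_min_size us sub; rewrite ?size_oneline ?size_iota.
Qed.

Lemma oneline_surj n w : word n w -> exists s : 'S_n, oneline s = w.
Proof.
move=> hw; have szw := word_size _ _ hw.
(* Letters start at 1 and ordinals at 0; positivity makes the shift by [predn] reversible. *)
have bnd (i : 'I_n) : (nth 0 w i).-1 < n /\ 0 < nth 0 w i.
  have : nth 0 w i \in w by rewrite mem_nth ?szw.
  by rewrite (perm_mem hw) mem_iota add1n ltnS; case: (nth 0 w i).
pose f i := Ordinal (proj1 (bnd i)).
have finj : injective f.
  move=> i j [] e; apply/val_inj/eqP.
  rewrite -(@nth_uniq _ 0 w) ?szw ?ltn_ord ?(perm_uniq hw) ?iota_uniq //.
  by rewrite -(prednK (proj2 (bnd i))) e (prednK (proj2 (bnd j))).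
exists (perm finj); apply: (@eq_from_nth _ 0); rewrite size_oneline ?szw // => i hi.
by rewrite (nth_oneline _ _ (Ordinal hi)) permE /= (prednK (proj2 (bnd (Ordinal hi)))).
Qed.

Lemma simsun_oneline n (s : 'S_n) : simsun s = wsimsun (oneline s).
Proof.
apply/forallP/allP => h k.
  rewrite size_oneline mem_iota add0n => /andP[_ hk].
  by have := h (Ordinal hk); rewrite /= no_double_descentE.
rewrite no_double_descentE; apply: h.
by rewrite size_oneline mem_iota ltn_ord.
Qed.

Lemma wavoidsP (r : nat -> nat -> nat -> bool) w :
  reflect (forall i j k, i < j < k -> k < size w ->
             ~~ r (nth 0 w i) (nth 0 w j) (nth 0 w k))
    (wavoids r w).
Proof.
elim: w => [|a w IHw] /=; first by left.
apply: (iffP andP) => [[/(pairwiseP 0) ha /IHw hw]|h].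
  move=> i [|j] [|k] /andP[] //; case: i => [|i] hij hjk hk.
    by apply: ha => //; apply: (ltn_trans hjk hk).
  by apply: hw => //; apply/andP; split.
split; last by apply/IHw => i j k hij hk; apply: (h i.+1 j.+1 k.+1).
by apply/(pairwiseP 0) => j k hj hk hjk; apply: (h 0 j.+1 k.+1).
Qed.

(** Replaces order isomorphism with [p] by explicit inequalities between three values, so that both
    patterns share one translation to words. *)
Definition pattern_rel (p : 'S_3) (r : nat -> nat -> nat -> bool) : Prop :=
  forall x : 'I_3 -> nat,
  [forall j : 'I_3, forall k : 'I_3, (x j < x k) == (p j < p k)]
    = r (x (inord 0)) (x (inord 1)) (x (inord 2)).

Lemma avoids_oneline n (p : 'S_3) (r : nat -> nat -> nat -> bool) (s : 'S_n) :
  pattern_rel p r -> avoids p s = wavoids r (oneline s).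
Proof.
move=> hr; apply/idP/wavoidsP => [av i j k /andP[ij jk] |h].
  rewrite size_oneline => hk; have hj := ltn_trans jk hk; have hi := ltn_trans ij hj.
  apply: contra av => rijk; apply/existsP.
  exists [ffun t : 'I_3 => tnth [tuple Ordinal hi; Ordinal hj; Ordinal hk] t].
  apply/andP; split.
    apply/forallP => -[[|[|[|?]]] ha] //; apply/forallP => -[[|[|[|?]]] hb] //=;
      by rewrite !ffunE !(tnth_nth (Ordinal hi)) //= (ltn_trans ij jk).
  (* The values are taken with a successor to match the letters of [oneline]; this leaves their
     comparisons unchanged. *)
  move: (hr (fun t => (s ([ffun t : 'I_3 =>
    tnth [tuple Ordinal hi; Ordinal hj; Ordinal hk] t] t)).+1)).
  rewrite !ffunE !(tnth_nth (Ordinal hi)) !inordK //= -!nth_oneline /= rijk.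
  exact.
apply/negP => /existsP[f /andP[/forallP mono]].
move: (hr (fun t => (s (f t)).+1)) => /= hrf.
have lt01 : f (inord 0) < f (inord 1).
  by move/forallP/(_ (inord 1))/implyP: (mono (inord 0)); apply; rewrite !inordK.
have lt12 : f (inord 1) < f (inord 2).
  by move/forallP/(_ (inord 2))/implyP: (mono (inord 1)); apply; rewrite !inordK.
have := h (f (inord 0)) (f (inord 1)) (f (inord 2)).
rewrite lt01 lt12 size_oneline ltn_ord !nth_oneline -hrf => /(_ isT isT) /negP.
exact.
Qed.

(** The chain in [r231] decides all nine comparisons, by transitivity, asymmetry and irreflexivity;
    conversely two of the comparisons give the chain. *)
Lemma pattern231 : pattern_rel p231 r231.
Proof.
move=> x; apply/forallP/idP => [h|/andP[hlo hhi] j].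
  have le i j : (x i < x j) = (p231 i < p231 j) by exact: (eqP (forallP (h i) j)).
  by rewrite /r231 !le !permE /fun231 !(tnth_nth ord0) !inordK.
have lohi := ltn_trans hlo hhi; apply/forallP => k.
have ordE m (hm : m < 3) : Ordinal hm = inord m by apply: val_inj; rewrite /= inordK.
have asym a b : a < b -> (b < a) = false by move=> /ltnW; rewrite ltnNge => ->.
case: j k => [[|[|[|?]]] ?] [[|[|[|?]]] ?] //; rewrite !ordE ?ltnn //.
all: rewrite ?hlo ?hhi ?lohi ?(asym _ _ hlo) ?(asym _ _ hhi) ?(asym _ _ lohi).
all: by rewrite !permE /fun231 !(tnth_nth ord0) !inordK.
Qed.

Lemma pattern213 : pattern_rel p213 r213.
Proof.
move=> x; apply/forallP/idP => [h|/andP[hlo hhi] j].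
  have le i j : (x i < x j) = (p213 i < p213 j) by exact: (eqP (forallP (h i) j)).
  by rewrite /r213 !le !permE /fun213 !(tnth_nth ord0) !inordK.
have lohi := ltn_trans hlo hhi; apply/forallP => k.
have ordE m (hm : m < 3) : Ordinal hm = inord m by apply: val_inj; rewrite /= inordK.
have asym a b : a < b -> (b < a) = false by move=> /ltnW; rewrite ltnNge => ->.
case: j k => [[|[|[|?]]] ?] [[|[|[|?]]] ?] //; rewrite !ordE ?ltnn //.
all: rewrite ?hlo ?hhi ?lohi ?(asym _ _ hlo) ?(asym _ _ hhi) ?(asym _ _ lohi).
all: by rewrite !permE /fun213 !(tnth_nth ord0) !inordK.
Qed.

(** * Cardinalities and the bijection *)

(** The words of the members of [A] and the level [gen ok n] are duplicate-free lists with the same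
    elements. *)
Lemma gen_card n (P : pred (seq nat)) ok (A : {set 'S_n}) :
  P [::] -> insertion_rule P ok -> (forall s, (s \in A) = P (oneline s)) ->
  #|A| = size (gen ok n).
Proof.
move=> P0 rule hA; rewrite cardE -(size_map (@oneline n)); apply: perm_size.
apply: uniq_perm; rewrite ?(gen_uniq P) //.
  by rewrite map_inj_uniq ?enum_uniq //; apply: oneline_inj.
move=> w; rewrite (mem_gen P) //; apply/mapP/andP => [[s + ->]|[hw Pw]].
  by rewrite mem_enum hA; split=> //; apply: word_oneline.
have [s e] := oneline_surj _ _ hw.
by exists s; rewrite // mem_enum hA e.
Qed.

Lemma eq_card_bij (T U : finType) : #|T| = #|U| -> exists f : T -> U, bijective f.
Proof.
move=> e; exists (fun x => enum_val (cast_ord e (enum_rank x))).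
exists (fun y => enum_val (cast_ord (esym e) (enum_rank y))) => x.
  by rewrite enum_valK cast_ordK enum_rankK.
by rewrite enum_valK cast_ordKV enum_rankK.
Qed.

Theorem theorem3p8 (n : nat) (hn : 1 <= n) :
  exists f : {s : 'S_n | s \in RS n p231} -> {s : 'S_n | s \in RS n p213},
    bijective f.
Proof.
apply: eq_card_bij; rewrite !card_sig.
have -> : #|[pred s | s \in RS n p231]| = size (gen ok231 n).
  apply: (gen_card _ simsun231) => // [|s]; first exact: insertion231.
  by rewrite inE simsun_oneline (avoids_oneline _ _ _ _ pattern231).
rewrite size_gen_eq; apply/esym; apply: (gen_card _ simsun213) => // [|s].
  exact: insertion213.
by rewrite inE simsun_oneline (avoids_oneline _ _ _ _ pattern213).
Qed.
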